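(* Let $R$ be an integral domain of characteristic $2$, let $M$ be a free $R$-module of finite rank with an antisymmetric bilinear form $\langle\cdot,\cdot\rangle : M\times M\to R$ such that $\langle x,x\rangle=0$ for all $x\in M$, and let $(M,* )$ be the associated symplectic quandle, $x*y = x+\langle x,y\rangle y$. Assume that $(M,* )$ is nontrivial. If $\langle\cdot,\cdot\rangle$ is nondegenerate, then the identity map of $M$ is the only good involution of $(M,* )$ (good involutions are not assumed to be $R$-linear).
   Context: A quandle is a set $X$ with a binary operation $*$ such that $x*x=x$ for all $x$; for all $x,y\in X$ there is a unique $z\in X$ with $z*y=x$; and $(x*y)*z=(x*z)*(y*z)$ for all $x,y,z$. The dual operation $*^{-1}$ is defined by $(x*y)*^{-1}y=x$ and $(x*^{-1}y)*y=x$. A quandle is trivial if $x*y=x$ for all $x,y$. An involution of $X$ is a map $\rho:X\to X$ with $\rho\circ\rho=\mathrm{id}_X$ (the identity is allowed). A good involution of $(X,* )$ is an involution $\rho$ such that (1) $\rho(x*y)=\rho(x)*y$ and (2) $x*\rho(y)=x*^{-1}y$ for all $x,y\in X$. For a free module $M$ of finite rank over a commutative ring $R$ with identity, with an antisymmetric bilinear form satisfying $\langle x,x\rangle=0$ for all $x$, the symplectic quandle $(M,* )$ is given by $x*y=x+\langle x,y\rangle y$; its dual operation is $x*^{-1}y=x-\langle x,y\rangle y$. A symplectic quandle is nontrivial if it is not a trivial quandle. The form is nondegenerate if the map $M\to M^{\vee}=\mathrm{Hom}_R(M,R)$, $x\mapsto\langle x,-\rangle$, is injective. *)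

(* Defs.v *)
From HB Require Import structures.
From mathcomp Require Import all_boot all_order all_algebra.

Set Implicit Arguments.
Unset Strict Implicit.
Unset Printing Implicit Defensive.

Import GRing.Theory.
Local Open Scope ring_scope.

Declare Scope quandle_scope.
Delimit Scope quandle_scope with quandle.
Local Open Scope quandle_scope.

HB.mixin Record isQuandle X of Choice X := {
  qop : X -> X -> X;
  qopxx : forall x, qop x x = x;
  qop_unique_div : forall x y, exists! z, qop z y = x;
  qop_selfdistr : forall x y z, qop (qop x y) z = qop (qop x z) (qop y z)
}.

#[short(type="quandleType")]
HB.structure Definition Quandle := { X of isQuandle X & Choice X }.

Notation "x |> y" := (qop x y)
  (at level 40, left associativity) : quandle_scope.

Section QuandleTheory.
Variable X : quandleType.
Implicit Types x y z : X.

Fact qdual_subproof x y : exists z, z |> y == x.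
Proof. by have [z [/eqP zy _]] := qop_unique_div x y; exists z. Qed.

Definition qdual x y : X := xchoose (qdual_subproof x y).

Lemma qdualK x y : qdual x y |> y = x.
Proof. exact/eqP/(xchooseP (qdual_subproof x y)). Qed.

Lemma qdual_unique x y z : z |> y = x -> qdual x y = z.
Proof.
by have [w [_ wP]] := qop_unique_div x y => /wP <-; rewrite -(wP _ (qdualK x y)).
Qed.

Lemma qopK x y : qdual (x |> y) y = x.
Proof. exact: qdual_unique. Qed.

End QuandleTheory.

Notation "x |>^-1 y" := (qdual x y)
  (at level 40, left associativity) : quandle_scope.

Definition trivial_quandle (X : quandleType) : Prop :=
  forall x y : X, x |> y = x.

Record good_involution (X : quandleType) (rho : X -> X) : Prop := {
  good_involutionK : involutive rho;
  good_involution_opl : forall x y, rho (x |> y) = rho x |> y;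
  good_involution_opr : forall x y, x |> rho y = x |>^-1 y
}.

(* A free module of finite rank over R is a [vectType R]: an R-module that is
   linearly isomorphic to some 'rV[R]_n.  [{skew_symmetric M}] bundles
   bilinearity with f x y = - f y x; over a ring where 2 is not regular this
   does not imply f x x = 0. *)
Definition alternating (R : comNzRingType) (M : vectType R)
  (f : {skew_symmetric M}) : Prop := forall x, f x x = 0.

(* The notion of sesquilinear.v is restricted to forms over a field;
   [linfun (f x)] is the linear form f x -, as an element of the dual of M. *)
Definition nondegenerate_form (R : comNzRingType) (M : vectType R)
  (f : {skew_symmetric M}) : Prop :=
  injective (fun x : M => linfun (f x : M -> R^o)).

Section SymplecticQuandle.
Variables (R : comNzRingType) (M : vectType R) (f : {skew_symmetric M}).
Hypothesis f_alt : alternating f.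

Lemma linfun_formE x y : (linfun (f x : M -> R^o)) y = f x y.
Proof.
have f_lin : linear (f x : M -> R^o).
  by move=> a u v; rewrite linearPr.
pose H := GRing.isLinear.Build R M R^o *:%R (f x) f_lin.
pose g : {linear M -> R^o} := HB.pack (f x : M -> R^o) H.
exact: (lfunE g y).
Qed.

(* The carrier is an alias of M, tagged by the form and the proof that it is
   alternating. *)
Definition symplectic_quandle & alternating f : Type := M.

Local Notation Q := (symplectic_quandle f_alt).

HB.instance Definition _ := Choice.on Q.

Definition symplectic_op (x y : M) : M := x + f x y *: y.

Fact symplectic_opxx x : symplectic_op x x = x.
Proof. by rewrite /symplectic_op f_alt scale0r addr0. Qed.

Fact form_opl x y : f (symplectic_op x y) y = f x y.
Proof. by rewrite /symplectic_op linearDl linearZl_LR /= f_alt mulr0 addr0. Qed.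

Fact symplectic_opBK x y : symplectic_op (x - f x y *: y) y = x.
Proof.
by rewrite /symplectic_op linearBl linearZl_LR /= f_alt mulr0 subr0 subrK.
Qed.

Fact symplectic_op_unique_div x y : exists! z, symplectic_op z y = x.
Proof.
exists (x - f x y *: y); split; first exact: symplectic_opBK.
by move=> z <-; rewrite form_opl addrK.
Qed.

Fact form_op2 x y z : f (symplectic_op x z) (symplectic_op y z) = f x y.
Proof.
rewrite linearDr linearZr_LR /= form_opl /symplectic_op linearDl linearZl_LR.
have /= -> : f z y = - f y z.
  by rewrite (@hermitian_subproof _ _ _ _ f z y) expr1 mulN1r.
by rewrite mulrN -addrA [f y z * _]mulrC addNr addr0.
Qed.

Fact symplectic_op_selfdistr x y z :
  symplectic_op (symplectic_op x y) z =
  symplectic_op (symplectic_op x z) (symplectic_op y z).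
Proof.
rewrite [RHS]/symplectic_op form_op2 [LHS]/symplectic_op.
rewrite /symplectic_op linearDl linearZl_LR /= scalerDr scalerDl scalerA.
by rewrite !addrA; congr (_ + _); rewrite addrAC.
Qed.

HB.instance Definition _ := isQuandle.Build Q
  symplectic_opxx symplectic_op_unique_div symplectic_op_selfdistr.

Lemma symplectic_qopE (x y : Q) : x |> y = (x : M) + f x y *: (y : M).
Proof. by []. Qed.

Lemma symplectic_qdualE (x y : Q) : x |>^-1 y = (x : M) - f x y *: (y : M).
Proof. exact/qdual_unique/symplectic_opBK. Qed.

End SymplecticQuandle.

(* Main.v *)
Require Import Defs.
From mathcomp Require Import all_boot all_order all_algebra.

Set Implicit Arguments.
Unset Strict Implicit.
Unset Printing Implicit Defensive.

Import GRing.Theory.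
Local Open Scope ring_scope.

(** In characteristic 2 each translation [x |-> x + f x y *: y] is its own
    inverse, so the identity is a good involution.  Conversely, let [rho] be a
    good involution and write [r] for [rho y].  The second axiom says that
    [f x r *: r = - f x y *: y] for all [x].  Pairing this with [x] yields
    [f x r ^+ 2 = - f x y ^+ 2], which in an integral domain of characteristic
    2 means [f x r = f x y] ([form_dual_op]).  Since [x] is arbitrary, [r] and
    [y] define the same linear form, and nondegeneracy gives [r = y]. *)

Lemma skew_formC (R : comNzRingType) (M : vectType R) (f : {skew_symmetric M})
  (x y : M) : f x y = - f y x.
Proof. by rewrite (@hermitian_subproof _ _ _ _ f x y) expr1 mulN1r. Qed.

Lemma nondegenerate_formP (R : comNzRingType) (M : vectType R)
    (f : {skew_symmetric M}) (f_nondeg : nondegenerate_form f) (y z : M) :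
  (forall x, f x y = f x z) -> y = z.
Proof.
move=> fyz; apply/f_nondeg/lfunP => x.
by rewrite !linfun_formE skew_formC fyz -skew_formC.
Qed.

(** Pairing both sides of the hypothesis with [x] compares squares of scalars;
    characteristic 2 is what removes the sign ambiguity of the square root. *)
Lemma form_dual_op (R : idomainType) (R_char2 : 2%N \in [pchar R])
    (M : vectType R) (f : {skew_symmetric M}) (x y z : M) :
  x + f x z *: z = x - f x y *: y -> f x z = f x y.
Proof.
move=> /addrI /(congr1 (f x)).
rewrite linearN /= !linearZr_LR /= (oppr_pchar2 R_char2) -!expr2 => /eqP.
by rewrite eqf_sqr (oppr_pchar2 R_char2) orbb => /eqP.
Qed.

Theorem theorem1p4 (R : idomainType) (R_char2 : 2%N \in [pchar R])
    (M : vectType R) (f : {skew_symmetric M}) (f_alt : alternating f)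
    (nontrivial : ~ trivial_quandle (symplectic_quandle f_alt))
    (f_nondeg : nondegenerate_form f)
    (rho : symplectic_quandle f_alt -> symplectic_quandle f_alt) :
  good_involution rho <-> rho =1 id.
Proof.
split=> [[_ _ rho_opr] y | rho_id].
  apply: (nondegenerate_formP f_nondeg) => x.
  apply: (form_dual_op R_char2).
  by rewrite -symplectic_qopE rho_opr symplectic_qdualE.
split=> [x | x y | x y]; rewrite !rho_id //.
by rewrite symplectic_qopE symplectic_qdualE -scaleNr (oppr_pchar2 R_char2).
Qed.
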